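(* Let $A,B$ be free noncommutative variables. Then, in $\exp(\hat{\mathfrak f}_2)$, $$\Phi(A,B)=2^{B}\,\Psi_2(A\,|\,B,-A-B)\,2^{A},$$ where $\Phi$ is the Knizhnik–Zamolodchikov associator and $\Psi_2$ is its analogue for square roots of unity, as defined in the context.
   Context: Let $\hat{\mathfrak f}_2$ (resp. $\hat{\mathfrak f}_3$) be the topologically free complex Lie algebra generated by $A,B$ (resp. $A,b_0,b_1$), i.e. the degree completion of the free Lie algebra, all generators having degree $1$. For $x$ in a pronilpotent Lie algebra and $a\in\mathbb C\setminus\mathbb R_-$, $a^x:=\exp(x\ln a)$, where $\ln a$ has imaginary part in $]-\pi,\pi[$. Definition of $\Phi$: $\Phi(A,B)=G_1^{-1}G_0\in\exp(\hat{\mathfrak f}_2)$, where $G_0,G_1$ are the $\exp(\hat{\mathfrak f}_2)$-valued solutions on $]0,1[$ of $$(dG)G^{-1}=\Big(\frac{A}{u}+\frac{B}{u-1}\Big)du$$ such that $G_0(u)\simeq u^{A}$ as $u\to0^+$ and $G_1(u)\simeq(1-u)^{B}$ as $u\to1^-$ (i.e. $G_0(u)u^{-A}\to1$, $G_1(u)(1-u)^{-B}\to1$). Definition of $\Psi_2$: $\Psi_2(A|b_0,b_1)=H_1^{-1}H_0\in\exp(\hat{\mathfrak f}_3)$, where $H_0,H_1$ are the $\exp(\hat{\mathfrak f}_3)$-valued solutions on $]0,1[$ of $$(dH)H^{-1}=\Big(\frac{A}{z}+\frac{b_0}{z-1}+\frac{b_1}{z+1}\Big)dz$$ such that $H_0(z)\simeq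 z^{A}$ as $z\to0^+$ and $H_1(z)\simeq(1-z)^{b_0}$ as $z\to1^-$ (same meaning of $\simeq$). For degree-one elements $x,y_0,y_1$ of a degree-completed graded Lie algebra $\hat{\mathfrak g}$ (with $\mathfrak g$ generated in degree $1$), $\Psi_2(x|y_0,y_1)\in\exp(\hat{\mathfrak g})$ denotes the image of $\Psi_2(A|b_0,b_1)$ under the morphism induced by $A\mapsto x$, $b_0\mapsto y_0$, $b_1\mapsto y_1$. *)

(* Defs.v *)
From HB Require Import structures.
From mathcomp Require Import all_boot all_order all_algebra.
From mathcomp Require Import all_classical all_reals all_analysis.
From mathcomp Require Import complex.

Set Implicit Arguments.
Unset Strict Implicit.
Unset Printing Implicit Defensive.

Import Order.TTheory GRing.Theory Num.Theory.
Import numFieldNormedType.Exports.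

Local Open Scope classical_set_scope.
Local Open Scope ring_scope.
Local Open Scope complex_scope.

(* K<<X_0, ..., X_(n-1)>>, the degree completion of the free associative
   algebra: a series is the family of its coefficients, indexed by words. *)
Definition ncseries (K : fieldType) (n : nat) : Type := seq 'I_n -> K.

Section NCSeriesAlgebra.
Variables (K : fieldType) (n : nat).
Local Notation S := (ncseries K n).
Implicit Types (f g h : S) (w : seq 'I_n).

Definition nc_add f g : S := fun w => f w + g w.
Definition nc_opp f : S := fun w => - f w.
Definition nc_zero : S := fun=> 0.
Definition nc_one : S := fun w => (w == [::])%:R.
Definition nc_mul f g : S :=
  fun w => \sum_(i < (size w).+1) f (take i w) * g (drop i w).
Definition nc_scale (a : K) f : S := fun w => a * f w.

Fact nc_addA : associative nc_add.
Proof. by move=> f g h; apply/funext => w; rewrite /nc_add addrA. Qed.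
Fact nc_addC : commutative nc_add.
Proof. by move=> f g; apply/funext => w; rewrite /nc_add addrC. Qed.
Fact nc_add0 : left_id nc_zero nc_add.
Proof. by move=> f; apply/funext => w; rewrite /nc_add add0r. Qed.
Fact nc_addN : left_inverse nc_zero nc_opp nc_add.
Proof. by move=> f; apply/funext => w; rewrite /nc_add /nc_opp addNr. Qed.

HB.instance Definition _ := gen_eqMixin S.
HB.instance Definition _ := gen_choiceMixin S.
HB.instance Definition _ := GRing.isZmodule.Build S
  nc_addA nc_addC nc_add0 nc_addN.

Fact nc_mulA : associative nc_mul.
Proof.
move=> f g h; apply/funext => w; rewrite /nc_mul.
transitivity (\sum_(i < (size w).+1) \sum_(j < (size w).+1 | (i <= j)%N)
    f (take i w) * g (drop i (take j w)) * h (drop j w)).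
  apply: eq_bigr => i _; rewrite size_drop mulr_sumr.
  have le_iw : (i <= size w)%N by rewrite -ltnS.
  rewrite -(big_mkord xpredT (fun k => f (take i w) *
    (g (take k (drop i w)) * h (drop k (drop i w))))).
  rewrite -(big_mkord (fun j => (i <= j)%N) (fun j =>
    f (take i w) * g (drop i (take j w)) * h (drop j w))).
  rewrite [RHS](big_cat_nat (n := i)) //=; last exact: leqW.
  rewrite [X in _ = X + _]big_nat_cond.
  rewrite [X in _ = X + _]big_pred0 ?add0r => [|j]; last first.
    by rewrite /= ltnNge; case: (i <= j)%N; rewrite ?andbF.
  rewrite [RHS](big_addn 0 _ i) subSn //.
  rewrite [RHS](eq_bigl xpredT) => [|j]; last by rewrite leq_addl.
  apply: eq_bigr => j _.
  by rewrite mulrA take_drop drop_drop.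
rewrite (exchange_big_dep xpredT) //=; apply: eq_bigr => j _.
have le_jw : (j <= size w)%N by rewrite -ltnS.
rewrite mulr_suml size_takel //.
rewrite -(big_mkord (fun i => (i <= j)%N) (fun i =>
    f (take i w) * g (drop i (take j w)) * h (drop j w))).
rewrite -(big_mkord xpredT (fun i =>
    f (take i (take j w)) * g (drop i (take j w)) * h (drop j w))).
rewrite (big_cat_nat (n := j.+1)) //= [X in _ + X]big_nat_cond.
rewrite [X in _ + X]big_pred0 ?addr0 => [|i]; last first.
  by rewrite /= ltnNge; case: (i <= j)%N; rewrite ?andbF.
rewrite big_nat_cond [RHS]big_nat_cond.
apply: eq_big => i; first by rewrite /= ltnS; case: (i <= j)%N; rewrite ?andbF.
by case/andP=> _ le_ij; rewrite take_takel.
Qed.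

Fact nc_mul1l : left_id nc_one nc_mul.
Proof.
move=> f; apply/funext => w; rewrite /nc_mul big_ord_recl /= take0 drop0.
rewrite /nc_one eqxx mul1r big1 ?addr0 // => i _.
by rewrite -size_eq0 size_takel ?ltn_ord // mul0r.
Qed.

Fact nc_mul1r : right_id nc_one nc_mul.
Proof.
move=> f; apply/funext => w; rewrite /nc_mul big_ord_recr /= take_size drop_size.
rewrite /nc_one eqxx mulr1 big1 ?add0r // => i _.
by rewrite -size_eq0 size_drop subn_eq0 leqNgt ltn_ord mulr0.
Qed.

Fact nc_mulDl : left_distributive nc_mul nc_add.
Proof.
move=> f g h; apply/funext => w; rewrite /nc_mul /nc_add -big_split /=.
by apply: eq_bigr => i _; rewrite mulrDl.
Qed.

Fact nc_mulDr : right_distributive nc_mul nc_add.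
Proof.
move=> f g h; apply/funext => w; rewrite /nc_mul /nc_add -big_split /=.
by apply: eq_bigr => i _; rewrite mulrDr.
Qed.

Fact nc_one_neq0 : nc_one != nc_zero.
Proof.
apply/eqP => /(congr1 (fun f : S => f [::])).
by rewrite /nc_one /nc_zero eqxx; apply/eqP/oner_neq0.
Qed.

HB.instance Definition _ := GRing.Zmodule_isNzRing.Build S
  nc_mulA nc_mul1l nc_mul1r nc_mulDl nc_mulDr nc_one_neq0.

Fact nc_scaleA (a b : K) f : nc_scale a (nc_scale b f) = nc_scale (a * b) f.
Proof. by apply/funext => w; rewrite /nc_scale mulrA. Qed.
Fact nc_scale1 : left_id 1 nc_scale.
Proof. by move=> f; apply/funext => w; rewrite /nc_scale mul1r. Qed.
Fact nc_scaleDr : right_distributive nc_scale +%R.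
Proof. by move=> a f g; apply/funext => w; exact: mulrDr. Qed.
Fact nc_scaleDl f : {morph nc_scale^~ f : a b / a + b}.
Proof. by move=> a b; apply/funext => w; exact: mulrDl. Qed.

HB.instance Definition _ := GRing.Zmodule_isLmodule.Build K S
  nc_scaleA nc_scale1 nc_scaleDr nc_scaleDl.

Fact nc_scaleAl (a : K) (f g : S) : a *: (f * g) = (a *: f) * g.
Proof.
apply/funext => w; rewrite [LHS]mulr_sumr.
by apply: eq_bigr => i _; rewrite mulrA.
Qed.
HB.instance Definition _ := GRing.Lmodule_isLalgebra.Build K S nc_scaleAl.

Fact nc_scaleAr (a : K) (f g : S) : a *: (f * g) = f * (a *: g).
Proof.
apply/funext => w; rewrite [LHS]mulr_sumr.
by apply: eq_bigr => i _; rewrite mulrCA.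
Qed.
HB.instance Definition _ := GRing.Lalgebra_isAlgebra.Build K S nc_scaleAr.

Definition nc_is_inv f g := g * f = 1 /\ f * g = 1.
Definition nc_unit : {pred S} := fun f => `[< exists g, nc_is_inv f g >].
Definition nc_inv f : S := xget f [set g | nc_is_inv f g].

Fact nc_invP f : f \in nc_unit -> nc_is_inv f (nc_inv f).
Proof. by move=> /asboolP [g fg]; rewrite /nc_inv; case: xgetP => [h _ //|/(_ g)]. Qed.
Fact nc_mulV : {in nc_unit, left_inverse 1 nc_inv *%R}.
Proof. by move=> f /nc_invP[]. Qed.
Fact nc_mulrV : {in nc_unit, right_inverse 1 nc_inv *%R}.
Proof. by move=> f /nc_invP[]. Qed.
Fact nc_unitP f g : g * f = 1 /\ f * g = 1 -> f \in nc_unit.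
Proof. by move=> fg; apply/asboolP; exists g. Qed.
Fact nc_inv_out : {in [predC nc_unit], nc_inv =1 id}.
Proof.
move=> f /asboolP nf; rewrite /nc_inv; case: xgetP => // h _ fh.
by case: nf; exists h.
Qed.
HB.instance Definition _ := GRing.NzRing_hasMulInverse.Build S
  nc_mulV nc_mulrV nc_unitP nc_inv_out.

Definition ncX (i : 'I_n) : S := fun w => (w == [:: i])%:R.

(* The homogeneous component of degree d. *)
Definition nchom (d : nat) f : S := fun w => if size w == d then f w else 0.

(* The exponential of a series without constant term: x ^+ k has no
   coefficient on the words of length less than k. *)
Definition ncexp (x : S) : S :=
  fun w => \sum_(k < (size w).+1) (k`!%:R)^-1 * (x ^+ k) w.

(* The free Lie algebra on X_0, ..., X_(n-1), as the Lie subalgebra of the free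
   associative algebra generated by the letters. *)
Inductive lie_poly : S -> Prop :=
| lie_polyX i : lie_poly (ncX i)
| lie_poly0 : lie_poly 0
| lie_polyD x y : lie_poly x -> lie_poly y -> lie_poly (x + y)
| lie_polyZ a x : lie_poly x -> lie_poly (a *: x)
| lie_polyB x y : lie_poly x -> lie_poly y -> lie_poly (x * y - y * x).

(* Its degree completion. *)
Definition lie_series : set S := [set x | forall d, lie_poly (nchom d x)].

Definition exp_lie : set S := ncexp @` lie_series.

End NCSeriesAlgebra.

(* The image of f under the continuous algebra morphism X_i |-> y i, for series
   y i without constant term: a word longer than w contributes nothing to the
   coefficient of w. *)
Definition nceval (K : fieldType) (n m : nat) (y : 'I_n -> ncseries K m)
    (f : ncseries K n) : ncseries K m :=
  fun w => \sum_(k < (size w).+1) \sum_(v : k.-tuple 'I_n)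
    f v * (\prod_(i <- v) y i) w.

Section KZ.
Variable R : realType.
Local Notation C := R[i].

(* a^x = exp (x ln a), for real a > 0. *)
Definition ncpow (n : nat) (a : R) (x : ncseries C n) : ncseries C n :=
  ncexp ((ln a)%:C *: x).

(* Limits and derivatives are taken in the degree completion, that is,
   coefficient by coefficient. *)
Definition nccvg (n : nat) (f : R -> ncseries C n) (F : set_system R)
    (l : ncseries C n) : Prop :=
  forall w, (fun u => f u w : C^o) @ F --> (l w : C^o).

Definition ncderivable (n : nat) (f : R -> ncseries C n) (u : R) : Prop :=
  forall w, derivable (fun t => complex.Re (f t w)) u 1 /\
            derivable (fun t => complex.Im (f t w)) u 1.

Definition ncderive (n : nat) (f : R -> ncseries C n) (u : R) : ncseries C n :=
  fun w => derive1 (fun t => complex.Re (f t w)) u +i*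
           derive1 (fun t => complex.Im (f t w)) u.

(* G is an exp(\hat f_n)-valued solution on ]0,1[ of (dG) G^-1 = omega du. *)
Definition nc_solution (n : nat) (omega G : R -> ncseries C n) : Prop :=
  forall u : R, 0 < u < 1 ->
    [/\ exp_lie (G u), ncderivable G u & ncderive G u * (G u)^-1 = omega u].

(* M = G_1^-1 G_0, for the solutions G_0 and G_1 on ]0,1[ such that
   G_0(u) ~ u^x as u -> 0+ and G_1(u) ~ (1-u)^y as u -> 1-. *)
Definition regularized_holonomy (n : nat) (omega : R -> ncseries C n)
    (x y M : ncseries C n) : Prop :=
  exists G0 G1 : R -> ncseries C n,
    [/\ nc_solution omega G0,
        nccvg (fun u => G0 u * ncpow u (- x)) (0 : R)^'+ 1,
        nc_solution omega G1,
        nccvg (fun u => G1 u * ncpow (1 - u) (- y)) (1 : R)^'- 1 &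
        forall u : R, 0 < u < 1 -> M = (G1 u)^-1 * G0 u].

Definition is_Phi (Phi : ncseries C 2) : Prop :=
  let A := ncX C (0 : 'I_2) in let B := ncX C (1 : 'I_2) in
  regularized_holonomy
    (fun u => (u^-1)%:C *: A + ((u - 1)^-1)%:C *: B) A B Phi.

Definition is_Psi2 (Psi : ncseries C 3) : Prop :=
  let A := ncX C (0 : 'I_3) in
  let b0 := ncX C (1 : 'I_3) in let b1 := ncX C (2 : 'I_3) in
  regularized_holonomy
    (fun z => (z^-1)%:C *: A + ((z - 1)^-1)%:C *: b0 + ((z + 1)^-1)%:C *: b1)
    A b0 Psi.

(* Psi(x | y0, y1) *)
Definition eval3 (n : nat) (Psi : ncseries C 3) (x y0 y1 : ncseries C n) :
    ncseries C n :=
  nceval (tnth [tuple x; y0; y1]) Psi.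

End KZ.

(* Main.v *)
Require Import Defs.
From mathcomp Require Import all_boot all_order all_algebra.
From mathcomp Require Import all_classical all_reals all_analysis.
From mathcomp Require Import complex zify ring lra.

(** The Moebius map u = 2 z / (1 + z) sends ]0,1[ onto itself, fixes 0 and 1,
    and satisfies
      dlog u = dlog z - dlog (z + 1),  dlog (u - 1) = dlog (z - 1) - dlog (z + 1).
    Hence it pulls A du/u + B du/(u - 1) back to
      A dz/z + B dz/(z - 1) + (- A - B) dz/(z + 1),
    which is the form defining Psi2, specialized at (A, B, - A - B)
    (moebius_pullback). So if G0, G1 are the normalized solutions defining Phi
    and H0, H1 those defining Psi2, then G0(u(z)), G1(u(z)) and the images of
    H0(z), H1(z) under the specialization all solve one and the same equation.
    As u ~ 2 z at 0 and 1 - u ~ (1 - z) / 2 at 1, comparing the asymptotics gives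
      G0(u(z)) = H0(z) 2^A,   G1(u(z)) = H1(z) (1/2)^B,
    and the product G1^-1 G0 is 2^B (H1^-1 H0) 2^A.

    Both comparisons come from ncsolves_rescale, which rests on a uniqueness
    statement (ncsolves_eq0): a solution D such that D P tends to 0 at an end of
    the interval, for some P with constant term 1, vanishes. Indeed the form has
    no constant term, so the coefficients of D of lowest degree are constant; they
    are also the lowest coefficients of D P, which tend to 0.

    The algebra behind this is that specialization of the letters is a ring
    morphism (ncevalM) compatible with exponentials (nceval_exp), and that
    exp (x + y) = exp x exp y for commuting x and y (ncexpD). *)

Set Implicit Arguments.
Unset Strict Implicit.
Unset Printing Implicit Defensive.

Import Order.TTheory GRing.Theory Num.Theory.
Import numFieldNormedType.Exports.

Local Open Scope classical_set_scope.
Local Open Scope ring_scope.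

(** * Coefficients of noncommutative series *)

Section Coefficients.
Variables (K : fieldType) (n : nat).
Implicit Types (f g h x y : ncseries K n) (w v : seq 'I_n).

Lemma ncD f g w : (f + g) w = f w + g w. Proof. by []. Qed.
Lemma ncN f w : (- f) w = - f w. Proof. by []. Qed.
Lemma ncZ a f w : (a *: f) w = a * f w. Proof. by []. Qed.
Lemma nc0 w : (0 : ncseries K n) w = 0. Proof. by []. Qed.
Lemma nc1 w : (1 : ncseries K n) w = (w == [::])%:R. Proof. by []. Qed.
Lemma ncM f g w :
  (f * g) w = \sum_(i < (size w).+1) f (take i w) * g (drop i w).
Proof. by []. Qed.

Lemma ncMn f k w : (f *+ k) w = k%:R * f w.
Proof.
by elim: k => [|k IHk]; rewrite ?mulr0n ?mul0r // !mulrS ncD IHk mulrDl mul1r.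
Qed.

Lemma nc_sum (I : Type) (r : seq I) (P : pred I) (F : I -> ncseries K n) w :
  (\sum_(i <- r | P i) F i) w = \sum_(i <- r | P i) F i w.
Proof. exact: (big_morph (fun f : ncseries K n => f w) (fun f g => ncD f g w) (nc0 w)). Qed.

Lemma ncM_nil f g : (f * g) [::] = f [::] * g [::].
Proof. by rewrite ncM big_ord1. Qed.

Definition nctail i f : ncseries K n := fun w => f (i :: w).

Lemma ncM_cons i f g w :
  (f * g) (i :: w) = (nctail i f * g) w + f [::] * g (i :: w).
Proof. by rewrite !ncM big_ord_recl /= addrC. Qed.

Lemma eq_ncM f f' g g' w :
  (forall v, (size v <= size w)%N -> f v = f' v) ->
  (forall v, (size v <= size w)%N -> g v = g' v) ->
  (f * g) w = (f' * g') w.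
Proof.
move=> ff' gg'; rewrite !ncM; apply: eq_bigr => i _.
by rewrite ff' ?gg' // ?size_drop ?leq_subr // size_take_min geq_minr.
Qed.

(** A factor without constant term shifts degrees by one, so that only the
    shorter words of the other factor are seen. *)
Lemma eq_ncM_pos x g g' w : x [::] = 0 ->
  (forall v, (size v < size w)%N -> g v = g' v) -> (x * g) w = (x * g') w.
Proof.
move=> x0 gg'; rewrite !ncM; apply: eq_bigr => -[[|i] ltiw] _ /=.
  by rewrite take0 x0 !mul0r.
by rewrite gg' // size_drop ltn_subrL (leq_ltn_trans (leq0n i) ltiw).
Qed.

Lemma ncX_pos_eq0 x k w : x [::] = 0 -> (size w < k)%N -> (x ^+ k) w = 0.
Proof.
move=> x0; elim: k w => // k IHk w; rewrite ltnS => le_wk.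
rewrite exprS (@eq_ncM_pos x _ 0) ?mulr0 // => v lt_vw.
by rewrite IHk // (leq_trans lt_vw).
Qed.

(** Degree count: each factor without constant term contributes at least one
    letter. *)
Lemma ncXM_pos_eq0 x y j k w : x [::] = 0 -> y [::] = 0 ->
  (size w < j + k)%N -> (x ^+ j * y ^+ k) w = 0.
Proof.
move=> x0 y0 lt_w; rewrite ncM big1 // => i _.
have [lt_ij|le_ji] := ltnP i j.
  by rewrite ncX_pos_eq0 ?mul0r // size_take_min gtn_min lt_ij.
by rewrite (@ncX_pos_eq0 y) ?mulr0 // size_drop; have := ltn_ord i; lia.
Qed.

End Coefficients.

(** * Exponentials *)

Section Exponential.
Variables (K : numFieldType) (n : nat).
Implicit Types (x y : ncseries K n) (w : seq 'I_n).

(** All coefficients of degree at most N can be read off one truncation of the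
    exponential, which is an ordinary polynomial expression in x. *)
Lemma ncexpE N x w : x [::] = 0 -> (size w <= N)%N ->
  ncexp x w = (\sum_(k < N.+1) (k`!%:R)^-1 *: x ^+ k) w.
Proof.
move=> x0 le_wN; rewrite nc_sum /ncexp.
rewrite -(big_mkord xpredT (fun k => (k`!%:R)^-1 * (x ^+ k) w)).
rewrite -(big_mkord xpredT (fun k => ((k`!%:R)^-1 *: x ^+ k) w)).
rewrite [RHS](big_cat_nat (n := (size w).+1)) //=.
rewrite [X in _ = _ + X]big_nat_cond [X in _ = _ + X]big1 ?addr0 // => k.
by rewrite andbT => /andP[lt_wk _]; rewrite ncZ ncX_pos_eq0 ?mulr0.
Qed.

Lemma ncexp_nil x : ncexp x [::] = 1.
Proof. by rewrite /ncexp big_ord1 fact0 invr1 mul1r expr0 nc1. Qed.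

Lemma ncexp0 : ncexp (0 : ncseries K n) = 1.
Proof.
apply/funext => w; rewrite /ncexp big_ord_recl fact0 invr1 mul1r expr0.
by rewrite big1 ?addr0 // => i _; rewrite expr0n /= mulr0.
Qed.

(** Coefficientwise this is the Cauchy product of the two truncated exponential
    series: both sides become sums over the pairs (i, j) of
    x ^+ i * y ^+ j / (i! j!), and the pairs with i + j > size w vanish on w. *)
Lemma ncexpD x y : x [::] = 0 -> y [::] = 0 -> GRing.comm x y ->
  ncexp (x + y) = ncexp x * ncexp y.
Proof.
move=> x0 y0 cxy; apply/funext => w; set N := size w.
have xy0 : (x + y) [::] = 0 by rewrite ncD x0 y0 addr0.
pose t i j : ncseries K n := ((i`!%:R)^-1 * (j`!%:R)^-1) *: (x ^+ i * y ^+ j).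
(* Sort the pairs (i, j) by their sum m; the i-sum has at most one term. *)
transitivity ((\sum_(m < N.+1) \sum_(j < N.+1)
    \sum_(i < N.+1 | m == (i + j)%N :> nat) t i j) w).
  rewrite (@ncexpE N) // !nc_sum; apply: eq_bigr => m _.
  rewrite nc_sum exprDn_comm // ncZ nc_sum mulr_sumr.
  rewrite (big_ord_widen N.+1 (fun i => (m`!%:R)^-1 *
     (x ^+ (m - i) * y ^+ i *+ 'C(m, i)) w)) ?ltn_ord //.
  rewrite big_mkcond /=; apply: eq_bigr => j _; rewrite nc_sum.
  rewrite ltnS; case: leqP => [le_jm|lt_mj]; last first.
    by rewrite big1 // => i /eqP mE; move: lt_mj; rewrite mE ltnNge leq_addl.
  have ltmj : (m - j < N.+1)%N by rewrite (leq_ltn_trans (leq_subr _ _)).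
  rewrite (big_pred1 (Ordinal ltmj)) => [|i]; last first.
    by rewrite /= -[RHS]val_eqE /= -[RHS](eqn_add2r j) subnK // eq_sym.
  rewrite /t [RHS]ncZ ncMn mulrA; congr (_ * _).
  have fU k : (k`!%:R : K) != 0 by rewrite pnatr_eq0 -lt0n fact_gt0.
  rewrite -(bin_fact le_jm) !natrM; have bU : 'C(m, j)%:R != 0 :> K.
    by rewrite pnatr_eq0 -lt0n bin_gt0.
  by field; rewrite !fU bU.
rewrite (@eq_ncM _ _ _ (\sum_(k < N.+1) (k`!%:R)^-1 *: x ^+ k)
   _ (\sum_(k < N.+1) (k`!%:R)^-1 *: y ^+ k)); try by move=> v; exact: ncexpE.
rewrite mulr_sumr nc_sum nc_sum.
under eq_bigr do rewrite nc_sum.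
rewrite exchange_big /=; apply: eq_bigr => j _.
under eq_bigr do rewrite nc_sum.
rewrite mulr_suml nc_sum (exchange_big_dep xpredT) //=; apply: eq_bigr => i _.
rewrite -scalerAl -scalerAr scalerA -/(t i j).
case: (ltnP (i + j) N.+1) => [lt_ijN|lt_Nij].
  by rewrite (big_pred1 (Ordinal lt_ijN)) // => m; rewrite -val_eqE.
(* The pairs with i + j > N = size w appear only on the right, and vanish. *)
rewrite big1 => [|m /eqP mE]; last by move: lt_Nij; rewrite -mE leqNgt ltn_ord.
by rewrite /t [RHS]ncZ ncXM_pos_eq0 ?mulr0.
Qed.

Lemma ncexpNr x : x [::] = 0 -> ncexp x * ncexp (- x) = 1.
Proof.
move=> x0; rewrite -ncexpD ?subrr ?ncexp0 // ?ncN ?x0 ?oppr0 //.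
exact/commrN/commr_refl.
Qed.

Lemma ncexp_unit x : x [::] = 0 -> ncexp x \is a GRing.unit.
Proof.
move=> x0; apply/unitrP; exists (ncexp (- x)); split; last exact: ncexpNr.
by rewrite -{2}[x]opprK ncexpNr // ncN x0 oppr0.
Qed.

Lemma ncexpV x : x [::] = 0 -> (ncexp x)^-1 = ncexp (- x).
Proof. by move=> x0; rewrite -[LHS]mulr1 -(ncexpNr x0) mulKr ?ncexp_unit. Qed.

(** The letters have no constant term, and brackets create none. *)
Lemma lie_poly_nil x : lie_poly x -> x [::] = 0.
Proof.
elim=> {x} [i|//|x y _ x0 _ y0|a x _ x0|x y _ x0 _ y0] //.
- by rewrite ncD x0 y0 addr0.
- by rewrite ncZ x0 mulr0.
- by rewrite ncD ncN !ncM_nil x0 y0 mulr0 subrr.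
Qed.

Lemma exp_lie_unit x : exp_lie x -> x \is a GRing.unit.
Proof.
by case=> y /(_ 0) /lie_poly_nil y0 <-; apply: ncexp_unit; rewrite /nchom in y0.
Qed.

End Exponential.

(** * Specialization of the letters *)

Section Evaluation.
Variables (K : fieldType) (n m : nat) (y : 'I_n -> ncseries K m).
Hypothesis y0 : forall i, y i [::] = 0.
Implicit Types (f g : ncseries K n) (w : seq 'I_m).

Lemma eq_nceval f g w : (forall v, (size v <= size w)%N -> f v = g v) ->
  nceval y f w = nceval y g w.
Proof.
move=> fg; apply: eq_bigr => k _; apply: eq_bigr => v _.
by rewrite fg // size_tuple -ltnS.
Qed.

Lemma nceval_sum (I : Type) (r : seq I) (P : pred I) (F : I -> ncseries K n) :
  nceval y (\sum_(i <- r | P i) F i) = \sum_(i <- r | P i) nceval y (F i).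
Proof.
apply/funext => w; rewrite nc_sum /nceval [RHS]exchange_big /=.
apply: eq_bigr => k _; rewrite [RHS]exchange_big /=; apply: eq_bigr => v _.
by rewrite nc_sum mulr_suml.
Qed.

Lemma ncevalD f g : nceval y (f + g) = nceval y f + nceval y g.
Proof.
apply/funext => w; rewrite ncD /nceval -big_split; apply: eq_bigr => k _ /=.
by rewrite -big_split; apply: eq_bigr => v _ /=; rewrite ncD mulrDl.
Qed.

Lemma ncevalZ a f : nceval y (a *: f) = a *: nceval y f.
Proof.
apply/funext => w; rewrite ncZ /nceval mulr_sumr; apply: eq_bigr => k _.
by rewrite mulr_sumr; apply: eq_bigr => v _; rewrite ncZ mulrA.
Qed.

Lemma prod_letters_eq0 (v : seq 'I_n) w :
  (size w < size v)%N -> (\prod_(i <- v) y i) w = 0.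
Proof.
elim: v w => // i v IHv w; rewrite big_cons ltnS => le_wv.
rewrite (@eq_ncM_pos _ _ _ _ 0) ?mulr0 // => u lt_uw.
by rewrite IHv // (leq_trans lt_uw).
Qed.

Lemma sum_cons_tuple (V : nmodType) k (F : seq 'I_n -> V) :
  \sum_(v : k.+1.-tuple 'I_n) F v
  = \sum_(i < n) \sum_(v : k.-tuple 'I_n) F (i :: v).
Proof.
rewrite pair_big /= (reindex (fun p : 'I_n * k.-tuple 'I_n => cons_tuple p.1 p.2)) //=.
exists (fun v => (thead v, behead_tuple v)) => [[i v] _|v _] /=.
  by congr pair; exact: val_inj.
by rewrite [v in RHS]tuple_eta; apply: val_inj.
Qed.

Lemma nceval_trunc N f w : (size w <= N)%N ->
  nceval y f w
  = (\sum_(k < N.+1) \sum_(v : k.-tuple 'I_n) f v *: \prod_(i <- v) y i) w.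
Proof.
move=> le_wN; rewrite nc_sum /nceval.
under [RHS]eq_bigr do (rewrite nc_sum; under eq_bigr do rewrite ncZ).
pose F k := \sum_(v : k.-tuple 'I_n) f v * (\prod_(i <- v) y i) w.
rewrite -(big_mkord xpredT F) -[RHS](big_mkord xpredT F).
rewrite [RHS](big_cat_nat (n := (size w).+1)) //=.
rewrite [X in _ = _ + X]big_nat_cond [X in _ = _ + X]big1 ?addr0 // => k.
rewrite andbT => /andP[lt_wk _]; rewrite /F big1 // => v _.
by rewrite prod_letters_eq0 ?mulr0 ?size_tuple.
Qed.

(** Splitting off the first letter, f = f [::] + sum_i X_i * nctail i f. As y i
    has no constant term, this determines nceval f by recursion on the degree,
    which is how multiplicativity is obtained. *)
Lemma nceval_fix f :
  nceval y f = f [::] *: 1 + \sum_(i < n) y i * nceval y (nctail i f).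
Proof.
apply/funext => w.
rewrite (@nceval_trunc (size w).+1) // big_ord_recl /=.
rewrite [in LHS]ncD ncD nc_sum; congr (_ + _).
  rewrite (big_pred1 [tuple]) ?big_nil // => v; by rewrite [v]tuple0.
under eq_bigr => k _ do
  rewrite (@sum_cons_tuple _ k (fun v => f v *: \prod_(j <- v) y j)).
rewrite exchange_big !nc_sum; apply: eq_bigr => i _ /=.
rewrite (@eq_ncM_pos _ _ _ _ (\sum_(k < (size w).+1)
    \sum_(v : k.-tuple 'I_n) nctail i f v *: \prod_(j <- v) y j)) //; last first.
  by move=> v lt_vw; rewrite (@nceval_trunc (size w)) // ltnW.
rewrite mulr_sumr; congr (_ w : K); apply: eq_bigr => k _.
rewrite mulr_sumr; apply: eq_bigr => v _.
by rewrite big_cons -scalerAr.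
Qed.

Lemma nceval1 : nceval y 1 = 1.
Proof.
rewrite nceval_fix nc1 scale1r big1 ?addr0 // => i _.
have -> : nctail i (1 : ncseries K n) = 0 by apply/funext.
by rewrite -(scale0r 0) ncevalZ scale0r mulr0.
Qed.

(** Induction on the length of w: expanding both sides along the first letter
    by nceval_fix leaves products y i * _, whose values at w depend only on
    words shorter than w. *)
Lemma ncevalM f g : nceval y (f * g) = nceval y f * nceval y g.
Proof.
apply/funext => w; have [N] := ubnP (size w).
elim: N w f g => // N IHN w f g lt_wN.
rewrite nceval_fix ncM_nil [nceval y f]nceval_fix mulrDl mulr_suml.
rewrite -[_ *: 1 * _]scalerAl mul1r.
rewrite {1}(nceval_fix g) scalerDr scalerA -!addrA ncD [RHS]ncD; congr (_ + _).
rewrite scaler_sumr ncD !nc_sum -big_split; apply: eq_bigr => i _ /=.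
have -> : nctail i (f * g) = nctail i f * g + f [::] *: nctail i g.
  by apply/funext => v; rewrite /nctail ncM_cons.
rewrite ncevalD ncevalZ mulrDr -scalerAr ncD addrC; congr (_ + _).
rewrite -mulrA; apply: eq_ncM_pos => // v lt_vw.
by apply: IHN; rewrite (leq_trans lt_vw).
Qed.

Lemma ncevalX i : nceval y (ncX K i) = y i.
Proof.
rewrite nceval_fix [ncX K i [::]]/= scale0r add0r (bigD1 i) //= big1 ?addr0.
  suff -> : nctail i (ncX K i) = 1 by rewrite nceval1 mulr1.
  by apply/funext => v; rewrite /nctail /ncX nc1 eqseq_cons eqxx.
move=> j neq_ji; have -> : nctail j (ncX K i) = 0.
  by apply/funext => v; rewrite /nctail /ncX eqseq_cons (negPf neq_ji).
by rewrite -(scale0r 0) ncevalZ scale0r mulr0.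
Qed.

Lemma nceval_nil f : nceval y f [::] = f [::].
Proof.
rewrite nceval_fix ncD ncZ nc1 mulr1 nc_sum big1 ?addr0 // => i _.
by rewrite ncM_nil y0 mul0r.
Qed.

Lemma nceval_unit f : f \is a GRing.unit -> nceval y f \is a GRing.unit.
Proof.
move=> fU; apply/unitrP; exists (nceval y f^-1).
by rewrite -!ncevalM mulVr ?mulrV ?nceval1.
Qed.

Lemma ncevalV f : f \is a GRing.unit -> nceval y f^-1 = (nceval y f)^-1.
Proof.
move=> fU; rewrite -[LHS]mulr1 -(mulrV (nceval_unit fU)) mulrA -ncevalM.
by rewrite mulVr // nceval1 mul1r.
Qed.

End Evaluation.

(** On words of bounded length the exponential is a polynomial in x, so this
    follows from linearity and multiplicativity. *)
Lemma nceval_exp (K : numFieldType) n m (y : 'I_n -> ncseries K m)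
    (x : ncseries K n) :
  (forall i, y i [::] = 0) -> x [::] = 0 ->
  nceval y (ncexp x) = ncexp (nceval y x).
Proof.
move=> y0 x0; apply/funext => w.
rewrite (@ncexpE _ _ (size w)) ?nceval_nil //.
rewrite (@eq_nceval _ _ _ _ _ (\sum_(k < (size w).+1) (k`!%:R)^-1 *: x ^+ k));
  last by move=> v; exact: ncexpE.
rewrite nceval_sum; congr (_ w : K); apply: eq_bigr => k _; rewrite ncevalZ.
congr (_ *: _); elim: (k : nat) => [|j IHj]; first by rewrite !expr0 nceval1.
by rewrite !exprS ncevalM // IHj.
Qed.

(** * Derivatives of complex functions of a real variable *)

Local Open Scope complex_scope.

Section ComplexDerivative.
Variable R : realType.
Local Notation C := R[i].
Implicit Types (f g : R -> C) (c d e : C) (u : R).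

Definition is_cderive (u : R) f d :=
  is_derive u 1 (fun t => complex.Re (f t)) (complex.Re d) /\
  is_derive u 1 (fun t => complex.Im (f t)) (complex.Im d).

Lemma is_cderive_cst c u : is_cderive u (fun=> c) 0.
Proof. by split; exact: is_derive_cst. Qed.

Lemma is_cderiveD f g d e u : is_cderive u f d -> is_cderive u g e ->
  is_cderive u (fun t => f t + g t) (d + e).
Proof.
move=> [fr fi] [gr gi]; split.
- rewrite raddfD; under eq_fun do rewrite raddfD.
  exact: is_deriveD fr gr.
- rewrite raddfD; under eq_fun do rewrite raddfD.
  exact: is_deriveD fi gi.
Qed.

Lemma is_derive_lin (h k : R -> R) (a b dh dk u : R) :
  is_derive u 1 h dh -> is_derive u 1 k dk ->
  is_derive u 1 (fun t => a * h t + b * k t) (a * dh + b * dk).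
Proof.
by move=> hd kd; have := is_deriveD (is_deriveZ a hd) (is_deriveZ b kd).
Qed.

Lemma is_cderiveZ f c d u : is_cderive u f d ->
  is_cderive u (fun t => c * f t) (c * d).
Proof.
case: c d => [a b] [dr di] [/= fr fi]; split => /=.
- have -> : (fun t => complex.Re ((a +i* b) * f t)) =
    (fun t => a * complex.Re (f t) + (- b) * complex.Im (f t)).
    by apply/funext => t /=; case: (f t) => ? ? /=; rewrite mulNr.
  by rewrite -mulNr; exact: is_derive_lin.
- have -> : (fun t => complex.Im ((a +i* b) * f t)) =
    (fun t => a * complex.Im (f t) + b * complex.Re (f t)).
    by apply/funext => t /=; case: (f t).
  exact: is_derive_lin.
Qed.

Lemma is_cderive_sum (I : Type) (r : seq I) (P : pred I) (F : I -> R -> C)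
    (D : I -> C) u :
  (forall i, P i -> is_cderive u (F i) (D i)) ->
  is_cderive u (fun t => \sum_(i <- r | P i) F i t) (\sum_(i <- r | P i) D i).
Proof.
move=> FD; elim: r => [|i r IHr].
  by rewrite big_nil; under eq_fun do rewrite big_nil; exact: is_cderive_cst.
rewrite big_cons; under eq_fun do rewrite big_cons.
by case: ifP => // Pi; apply: is_cderiveD => //; exact: FD.
Qed.

Lemma is_cderive_comp f (phi : R -> R) d (e u : R) :
  is_cderive (phi u) f d -> is_derive u 1 phi e ->
  is_cderive u (fun t => f (phi t)) (e%:C * d).
Proof.
move=> [fr fi] phie.
have -> : e%:C * d = (complex.Re d * e) +i* (complex.Im d * e).
  by case: d {fr fi} => a b; congr (_ +i* _); rewrite /= ?mul0r ?subr0 ?addr0 mulrC.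
by split; exact: is_derive1_comp.
Qed.

Lemma is_derive_0_cst_itv (f : R -> R) (a b : R) :
  (forall u, a < u < b -> is_derive u 1 f 0) ->
  forall u v, a < u < b -> a < v < b -> f u = f v.
Proof.
move=> f0.
have H u v : a < u < b -> a < v < b -> u <= v -> f u = f v.
  move=> /andP[au ub] /andP[av vb] le_uv.
  have uv t : t \in `[u, v]%R -> a < t < b.
    by rewrite in_itv /= => /andP[ut tv]; rewrite (lt_le_trans au) // (le_lt_trans tv).
  have [||t _] := @MVT_segment R f (fun=> 0) u v le_uv.
  - by move=> t tuv; apply: f0; apply: uv; exact: subset_itv_oo_cc tuv.
  - by apply: derivable_within_continuous => t /uv /f0 [].
  - by rewrite mul0r => /eqP; rewrite subr_eq0 => /eqP.
move=> u v uab vab; case: (leP u v) => [|/ltW]; first exact: H.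
by move=> /(H _ _ vab uab).
Qed.

Lemma is_cderive_0_cst_itv f (a b : R) :
  (forall u, a < u < b -> is_cderive u f 0) ->
  forall u v, a < u < b -> a < v < b -> f u = f v.
Proof.
move=> f0 u v uab vab; apply/eqP; rewrite eq_complex; apply/andP; split; apply/eqP.
- by apply: (@is_derive_0_cst_itv (fun t => complex.Re (f t)) a b) uab vab => t /f0 [].
- by apply: (@is_derive_0_cst_itv (fun t => complex.Im (f t)) a b) uab vab => t /f0 [].
Qed.

End ComplexDerivative.

(** * Coefficientwise limits *)

Section Limits.
Variables (R : realType) (n : nat).
Local Notation C := R[i].
Implicit Types (f g : R -> ncseries C n) (l k x : ncseries C n).
Variables (F : set_system R).
Hypothesis FF : ProperFilter F.

Lemma nccvgB f g l k :
  nccvg f F l -> nccvg g F k -> nccvg (fun u => f u - g u) F (l - k).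
Proof. by move=> fl gk w; exact: cvgB (fl w) (gk w). Qed.

Lemma nccvgM f g l k :
  nccvg f F l -> nccvg g F k -> nccvg (fun u => f u * g u) F (l * k).
Proof.
move=> fl gk w; apply: (@cvg_big (C^o)); first exact: add_continuous.
by move=> i _; apply: (@cvgM C); [exact: fl|exact: gk].
Qed.

Lemma nccvg_near f g l : (\near F, f F = g F) -> nccvg f F l -> nccvg g F l.
Proof.
move=> fg fl w; apply: cvg_trans (fl w); apply: near_eq_cvg.
by apply: filterS fg => u ->.
Qed.

Lemma cvg_real_complex (s : R -> R) (a : R) :
  s @ F --> a -> (fun u => (s u)%:C : C^o) @ F --> (a%:C : C^o).
Proof.
move=> sa; apply/cvgrPdist_lt => eps eps0.
have /andP[/eqP eps_im eps_re] : (complex.Im eps == 0) && (0 < complex.Re eps).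
  by move: eps0; case: eps => a' b'; rewrite ltcE /= eq_sym.
have epsE : eps = (complex.Re eps)%:C by case: eps eps_im {eps0 eps_re} => ? ? /= ->.
move/cvgrPdist_lt : sa => /(_ _ eps_re); apply: filterS => u lt_u.
by rewrite epsE -raddfB normc_def /= expr0n /= addr0 sqrtr_sqr ltcR.
Qed.

Lemma nccvg_exp (s : R -> R) (a : R) x : s @ F --> a ->
  nccvg (fun u => ncexp ((s u)%:C *: x)) F (ncexp (a%:C *: x)).
Proof.
move=> sa w; apply: (@cvg_big (C^o)); first exact: add_continuous.
move=> k _; apply: (@cvgM C); first exact: cvg_cst.
rewrite exprZn.
under eq_fun do rewrite exprZn.
apply: (@cvgM C); last exact: cvg_cst.
elim: (k : nat) => [|j IHj].
  by under eq_fun do rewrite expr0; exact: cvg_cst.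
rewrite exprS; under eq_fun do rewrite exprS.
by apply: (@cvgM C); [exact: cvg_real_complex|exact: IHj].
Qed.

Lemma nccvg_pow (s : R -> R) (a : R) x : 0 < a -> s @ F --> a ->
  nccvg (fun u => ncpow (s u) x) F (ncpow a x).
Proof.
by move=> a0 sa; apply: nccvg_exp; apply: continuous_cvg sa; exact: continuous_ln.
Qed.

Lemma nccvg_comp (phi : R -> R) (G : set_system R) f l :
  phi @ F --> G -> nccvg f G l -> nccvg (fun u => f (phi u)) F l.
Proof. by move=> phiFG fl w; exact: cvg_comp phiFG (fl w). Qed.

Lemma nccvg_eval m (y : 'I_n -> ncseries C m) f l :
  nccvg f F l -> nccvg (fun u => nceval y (f u)) F (nceval y l).
Proof.
move=> fl w; apply: (@cvg_big (C^o)); first exact: add_continuous.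
move=> k _; apply: (@cvg_big (C^o)); first exact: add_continuous.
by move=> v _; apply: (@cvgM C); [exact: fl|exact: cvg_cst].
Qed.

End Limits.

(** * Powers a^x of a fixed series *)

Section Powers.
Variables (R : realType) (n : nat) (x : ncseries R[i] n).
Hypothesis x0 : x [::] = 0.

Lemma ncpowN (a : R) : ncpow a (- x) = ncexp ((- ln a)%:C *: x).
Proof. by rewrite /ncpow scalerN -scaleNr -raddfN. Qed.

Lemma ncpow1 : ncpow (1 : R) x = 1.
Proof. by rewrite /ncpow ln1 scale0r ncexp0. Qed.

Lemma scale_nil (c : R[i]) : (c *: x) [::] = 0.
Proof. by rewrite ncZ x0 mulr0. Qed.

Lemma ncexp_scaleD (r s : R) :
  ncexp (r%:C *: x) * ncexp (s%:C *: x) = ncexp ((r + s)%:C *: x).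
Proof.
have -> : (r + s)%:C *: x = r%:C *: x + s%:C *: x by rewrite raddfD scalerDl.
rewrite ncexpD; [by []|exact: scale_nil|exact: scale_nil|].
by rewrite /GRing.comm -!scalerAl -!scalerAr scalerA mulrC -scalerA.
Qed.

Lemma ncexp_scale_eqD (r s r' s' : R) : r + s = r' + s' ->
  ncexp (r%:C *: x) * ncexp (s%:C *: x) = ncexp (r'%:C *: x) * ncexp (s'%:C *: x).
Proof. by move=> rs; rewrite [LHS]ncexp_scaleD [RHS]ncexp_scaleD rs. Qed.

Lemma ncpow_unit (a : R) : ncpow a x \is a GRing.unit.
Proof. by apply: ncexp_unit; exact: scale_nil. Qed.

Lemma ncpow_invr (a : R) : 0 < a -> (ncpow a^-1 x)^-1 = ncpow a x.
Proof.
move=> a0; rewrite ncexpV; last exact: scale_nil.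
by rewrite -scaleNr -raddfN lnV ?opprK.
Qed.

End Powers.

(** * Solutions of dG = omega G *)

Section Solutions.
Variables (R : realType).
Local Notation C := R[i].

(** The linear form dG = omega G of the equation (dG) G^-1 = omega: it makes
    sense for G not invertible, in particular for a difference of solutions. *)
Definition ncsolves n (omega G : R -> ncseries C n) :=
  forall u : R, 0 < u < 1 -> forall w, is_cderive u (G^~ w) ((omega u * G u) w).

Lemma nc_solution_solves n (omega G : R -> ncseries C n) :
  nc_solution omega G -> ncsolves omega G.
Proof.
move=> sG u /sG [Gexp Gd Ge] w; have GU := exp_lie_unit Gexp.
have derive1P (f : R -> R) : derivable f u 1 -> is_derive u 1 f (derive1 f u).
  by rewrite derive1E; exact: derivableP.
rewrite -Ge (mulrVK GU); have [Gr Gi] := Gd w; split.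
- exact: derive1P Gr.
- exact: derive1P Gi.
Qed.

Lemma ncsolvesB n (omega F G : R -> ncseries C n) :
  ncsolves omega F -> ncsolves omega G ->
  ncsolves omega (fun u => F u - G u).
Proof.
move=> sF sG u u01 w; rewrite mulrBr ncD ncN -mulN1r.
under [X in is_cderive _ X]eq_fun do rewrite ncD ncN -mulN1r.
by apply: is_cderiveD; [exact: sF|apply: is_cderiveZ; exact: sG].
Qed.

Lemma ncsolvesMr n (omega G : R -> ncseries C n) c :
  ncsolves omega G -> ncsolves omega (fun u => G u * c).
Proof.
move=> sG u u01 w; rewrite mulrA ncM.
under [X in _ _ X]eq_bigr do rewrite mulrC.
have -> : (fun t => (G t * c) w) =
    (fun t => \sum_(i < (size w).+1) c (drop i w) * G t (take i w)).
  by apply/funext => t; rewrite ncM; apply: eq_bigr => i _; rewrite mulrC.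
by apply: is_cderive_sum => i _; apply: is_cderiveZ; exact: sG.
Qed.

Lemma ncsolves_eval n m (y : 'I_n -> ncseries C m) omega G :
  (forall i, y i [::] = 0) -> ncsolves omega G ->
  ncsolves (fun u => nceval y (omega u)) (fun u => nceval y (G u)).
Proof.
move=> y0 sG u u01 w; rewrite -ncevalM //.
apply: is_cderive_sum => k _; apply: is_cderive_sum => v _.
rewrite mulrC; under [X in is_cderive _ X]eq_fun do rewrite mulrC.
by apply: is_cderiveZ; exact: sG.
Qed.

Lemma ncsolves_comp n (omega G : R -> ncseries C n) (phi dphi : R -> R) :
  (forall u : R, 0 < u < 1 -> 0 < phi u < 1) ->
  (forall u : R, 0 < u < 1 -> is_derive u 1 phi (dphi u)) ->
  ncsolves omega G ->
  ncsolves (fun u => (dphi u)%:C *: omega (phi u)) (fun u => G (phi u)).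
Proof.
move=> phi01 phid sG u u01 w; rewrite -scalerAl ncZ.
exact: is_cderive_comp (sG _ (phi01 _ u01) w) (phid _ u01).
Qed.

Lemma eq_ncsolves n (omega omega' G : R -> ncseries C n) :
  (forall u : R, 0 < u < 1 -> omega u = omega' u) ->
  ncsolves omega G -> ncsolves omega' G.
Proof. by move=> om sG u u01 w; rewrite -(om _ u01); exact: sG. Qed.

(** Let w be a word such that D vanishes on all shorter words. The derivative
    (omega D) w only involves shorter words, as omega has no constant term, so
    D w is constant; and (D P) w = D w as P has constant term 1. Since D P tends
    to 0, this constant is 0. *)
Lemma ncsolves_eq0 n (omega D P : R -> ncseries C n) (F : set_system R) :
  ProperFilter F -> (\forall u \near F, 0 < u < 1) ->
  (forall u, omega u [::] = 0) -> ncsolves omega D ->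
  (forall u, P u [::] = 1) -> nccvg (fun u => D u * P u) F 0 ->
  forall u : R, 0 < u < 1 -> D u = 0.
Proof.
move=> FF F01 om0 sD P1 DP0.
suff D0 w u : 0 < u < 1 -> D u w = 0 by move=> u u01; apply/funext => w; exact: D0.
have [N] := ubnP (size w); elim: N w u => // N IHN w u; rewrite ltnS => le_wN u01.
have Dcst v : 0 < v < 1 -> D v w = D u w.
  move=> v01; apply: (@is_cderive_0_cst_itv _ (D^~ w) 0 1) => // t t01.
  rewrite -[X in is_cderive _ _ X](_ : (omega t * D t) w = 0); first exact: sD.
  rewrite (@eq_ncM_pos _ _ _ _ 0) ?mulr0 // => v' lt_v'.
  by apply: IHN => //; exact: leq_trans lt_v' le_wN.
have DPw v : 0 < v < 1 -> (D v * P v) w = D u w.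
  move=> v01; rewrite ncM big_ord_recr /= take_size drop_size P1 mulr1 Dcst //.
  rewrite big1 ?add0r // => i _; rewrite IHN ?mul0r // size_take_min.
  exact: leq_trans (leq_ltn_trans (geq_minl _ _) (ltn_ord i)) le_wN.
have DPc : (fun v => (D v * P v) w : C^o) @ F --> (D u w : C^o).
  by apply: cvg_near_cst; apply: filterS F01 => v; exact: DPw.
exact: (cvg_unique (@norm_hausdorff C C^o) DPc (DP0 w)).
Qed.

(** If G ~ (k s)^x and H ~ s^x at an end of the interval, with k tending to a,
    then G = H a^x. Indeed both sides are solutions, and their difference,
    multiplied by (k s)^(- x), is
      G (k s)^(- x) - (H s^(- x)) (a / k)^x,
    where both terms tend to 1. *)
Lemma ncsolves_rescale n (omega G H : R -> ncseries C n) (F : set_system R)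
    (s k : R -> R) (a : R) x :
  ProperFilter F -> (\forall u \near F, 0 < u < 1) ->
  (forall u, omega u [::] = 0) -> x [::] = 0 ->
  (forall u : R, 0 < u < 1 -> 0 < s u) -> (forall u : R, 0 < u < 1 -> 0 < k u) ->
  0 < a -> k @ F --> a ->
  ncsolves omega G -> nccvg (fun u => G u * ncpow (k u * s u) (- x)) F 1 ->
  ncsolves omega H -> nccvg (fun u => H u * ncpow (s u) (- x)) F 1 ->
  forall u : R, 0 < u < 1 -> G u = H u * ncpow a x.
Proof.
move=> FF F01 om0 x0 s0 k0 a0 ka sG G1 sH H1.
suff D0 u : 0 < u < 1 -> G u - H u * ncpow a x = 0.
  by move=> u /D0 /eqP; rewrite subr_eq0 => /eqP.
apply: (@ncsolves_eq0 _ omega (fun u => G u - H u * ncpow a x)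
  (fun u => ncpow (k u * s u) (- x)) F FF F01 om0).
- by apply: ncsolvesB; [exact: sG|exact: ncsolvesMr].
- by move=> v; exact: ncexp_nil.
have ak1 : nccvg (fun u => ncpow (a / k u) x) F 1.
  rewrite -(ncpow1 x); apply: nccvg_pow => //.
  rewrite -(divff (lt0r_neq0 a0)); apply: cvgM; first exact: cvg_cst.
  by apply: cvgV ka; exact: lt0r_neq0.
rewrite -(subrr 1) -{2}(mulr1 1).
apply: nccvg_near (nccvgB FF G1 (nccvgM FF H1 ak1)).
have factor (g h p q c r : ncseries C n) : p * q = c * r ->
    g * r - (h * p) * q = (g - h * c) * r.
  by move=> pq; rewrite mulrBl -!mulrA pq.
apply: filterS F01 => v v01; have [s1 k1] := (s0 _ v01, k0 _ v01).
suff E : ncpow (s v) (- x) * ncpow (a / k v) x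
       = ncpow a x * ncpow (k v * s v) (- x).
  exact: factor E.
have lnE : - ln (s v) + ln (a / k v) = ln a + - ln (k v * s v).
  by rewrite ln_div // lnM //; ring.
rewrite (ncpowN x (s v)) (ncpowN x (k v * s v)).
exact: (ncexp_scale_eqD x0 lnE).
Qed.

End Solutions.

(** * The Moebius substitution *)

Section Moebius.
Variable R : realType.
Implicit Types z : R.

(** Written as a slope times z: the slope 2 / (1 + z) tends to 2 at 0, which is
    the source of the factor 2^A. *)
Definition moebius z : R := 2 / (1 + z) * z.

Lemma moebius01 z : 0 < z < 1 -> 0 < moebius z < 1.
Proof.
move=> /andP[z0 z1]; have zp : 0 < 1 + z by lra.
by rewrite /moebius mulrAC divr_gt0 ?ltr_pdivrMr ?mul1r //=; lra.
Qed.

(** The factor (1 + z)^-1 in front of 1 - z tends to 1/2 at 1, which is the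
    source of the factor 2^B. *)
Lemma moebius_compl z : 0 < z < 1 -> 1 - moebius z = (1 + z)^-1 * (1 - z).
Proof.
move=> /andP[z0 z1]; have zp : 1 + z != 0 by apply: lt0r_neq0; lra.
by rewrite /moebius; field.
Qed.

Lemma is_derive_moebius z : 0 < z < 1 ->
  is_derive z 1 moebius (2 / (1 + z) ^+ 2).
Proof.
move=> /andP[z0 z1].
have z1N0 : 1 + z != 0 by apply: lt0r_neq0; lra.
have dD : is_derive z 1 (fun t : R => 1 + t) (0 + 1).
  by have := is_deriveD (is_derive_cst (1 : R) z (1 : R)) (is_derive_id z (1 : R)).
have dV := is_deriveV z1N0 dD.
have dM := is_deriveM (is_deriveZ 2 dV) (is_derive_id z 1).
apply: (is_derive_eq dM).
by rewrite /= /GRing.scale /=; field.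
Qed.

Lemma near_right01 : \forall z \near (0 : R)^'+, 0 < z < 1.
Proof.
by near=> z; apply/andP; split; near: z; [exact: nbhs_right_gt|exact: nbhs_right_lt].
Unshelve. all: by end_near.
Qed.

Lemma near_left01 : \forall z \near (1 : R)^'-, 0 < z < 1.
Proof.
by near=> z; apply/andP; split; near: z; [exact: nbhs_left_gt|exact: nbhs_left_lt].
Unshelve. all: by end_near.
Qed.

Lemma cvg_addl1 (z : R) (F : set_system R) : ProperFilter F -> F --> z ->
  (fun t : R => 1 + t) @ F --> 1 + z.
Proof. by move=> FF Fz; apply: cvgD; [exact: cvg_cst|exact: Fz]. Qed.

Lemma cvg_addl1V (z : R) (F : set_system R) : ProperFilter F -> 0 <= z -> F --> z ->
  (fun t : R => (1 + t)^-1) @ F --> (1 + z)^-1.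
Proof. by move=> FF z0 Fz; apply: cvgV; [by apply: lt0r_neq0; lra|exact: cvg_addl1]. Qed.

Lemma cvg_moebius z (F : set_system R) : ProperFilter F -> 0 <= z -> F --> z ->
  moebius @ F --> moebius z.
Proof.
move=> FF z0 Fz; apply: cvgM; last exact: Fz.
by apply: cvgM; [exact: cvg_cst|exact: cvg_addl1V].
Qed.

Lemma cvg_moebius_slope0 : (fun z : R => 2 / (1 + z)) @ (0 : R)^'+ --> (2 : R).
Proof.
have id0 : (0 : R)^'+ --> (0 : R) by exact: cvg_within.
have := cvgM (cvg_cst (2 : R)) (@cvg_addl1V 0 _ _ (lexx _) id0).
rewrite addr0 invr1 mulr1 => lim2; exact: lim2.
Qed.

Lemma cvg_moebius_slope1 : (fun z : R => (1 + z)^-1) @ (1 : R)^'- --> (2^-1 : R).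
Proof.
have id1 : (1 : R)^'- --> (1 : R) by exact: cvg_within.
exact: cvg_addl1V ler01 id1.
Qed.

Lemma cvg_moebius_right0 : moebius @ (0 : R)^'+ --> (0 : R)^'+.
Proof.
have id0 : (0 : R)^'+ --> (0 : R) by exact: cvg_within.
have := @cvg_moebius 0 _ _ (lexx _) id0; rewrite {2}/moebius mulr0 => m0 S S0.
have mS : \forall z \near (0 : R)^'+, 0 < moebius z -> S (moebius z) by exact: m0 S0.
apply: filterS2 mS near_right01 => z zS z01; apply: zS.
by have /andP[] := moebius01 z01.
Qed.

Lemma cvg_moebius_left1 : moebius @ (1 : R)^'- --> (1 : R)^'-.
Proof.
have id1 : (1 : R)^'- --> (1 : R) by exact: cvg_within.
have := @cvg_moebius 1 _ _ ler01 id1.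
have -> : moebius 1 = 1 by rewrite /moebius mulr1 divff // lt0r_neq0.
move=> m1 S S1.
have mS : \forall z \near (1 : R)^'-, moebius z < 1 -> S (moebius z) by exact: m1 S1.
apply: filterS2 mS near_left01 => z zS z01; apply: zS.
by have /andP[] := moebius01 z01.
Qed.

End Moebius.

(** By partial fractions, since u = 2 z / (z + 1) and u - 1 = (z - 1) / (z + 1). *)
Lemma moebius_pullback (R : realType) n (x y : ncseries R[i] n) (z : R) :
  0 < z < 1 ->
  (2 / (1 + z) ^+ 2)%:C *:
    (((moebius z)^-1)%:C *: x + ((moebius z - 1)^-1)%:C *: y) =
  (z^-1)%:C *: x + ((z - 1)^-1)%:C *: y + ((z + 1)^-1)%:C *: (- x - y).
Proof.
move=> /andP[z0 z1].
have z_neq0 : z != 0 by apply: lt0r_neq0.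
have z1_neq0 : z - 1 != 0 by rewrite -opprB oppr_eq0; apply: lt0r_neq0; lra.
have z1p_neq0 : 1 + z != 0 by apply: lt0r_neq0; lra.
have z1p_neq0' : z + 1 != 0 by rewrite addrC.
have dA : 2 / (1 + z) ^+ 2 * (moebius z)^-1 = z^-1 - (z + 1)^-1.
  by rewrite /moebius; field; rewrite ?z1p_neq0 ?z_neq0 ?z1p_neq0'.
have dB : 2 / (1 + z) ^+ 2 * (moebius z - 1)^-1 = (z - 1)^-1 - (z + 1)^-1.
  have -> : moebius z - 1 = (z - 1) / (1 + z) by rewrite /moebius; field.
  by field; rewrite ?z1_neq0 ?z1p_neq0 ?z1p_neq0'.
rewrite scalerDr !scalerA -!rmorphM /= dA dB !rmorphB /= !scalerBl scalerBr scalerN.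
by rewrite addrACA.
Qed.

(** A specialization preserves asymptotics: it carries the condition
    H ~ s^(X_i) to its image under X_i |-> x. *)
Lemma nccvg_eval_pow (R : realType) n m (y : 'I_n -> ncseries R[i] m) i x
    (F : set_system R) (s : R -> R) (H : R -> ncseries R[i] n) :
  ProperFilter F -> (forall j, y j [::] = 0) -> y i = x ->
  nccvg (fun z => H z * ncpow (s z) (- ncX R[i] i)) F 1 ->
  nccvg (fun z => nceval y (H z) * ncpow (s z) (- x)) F 1.
Proof.
move=> FF y0 yi Hlim; rewrite -(nceval1 y0).
have evE z : nceval y (H z * ncpow (s z) (- ncX R[i] i))
           = nceval y (H z) * ncpow (s z) (- x).
  rewrite ncevalM; last exact: y0.
  rewrite nceval_exp; [|exact: y0|by rewrite ncZ ncN oppr0 mulr0].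
  by rewrite ncevalZ -scaleN1r ncevalZ (ncevalX y0) yi scaleN1r.
by apply: nccvg_near (nccvg_eval FF Hlim); apply: nearW; exact: evE.
Qed.

Theorem proposition2p1 (R : realType)
    (Phi : ncseries R[i] 2) (Psi2 : ncseries R[i] 3)
    (A := ncX R[i] (0 : 'I_2)) (B := ncX R[i] (1 : 'I_2)) :
  is_Phi Phi -> is_Psi2 Psi2 ->
  Phi = ncpow 2 B * eval3 Psi2 A B (- A - B) * ncpow 2 A.
Proof.
move=> [G0 [G1 [sG0 G0lim sG1 G1lim PhiE]]] [H0 [H1 [sH0 H0lim sH1 H1lim PsiE]]].
set y := tnth [tuple A; B; - A - B].
have A0 : A [::] = 0 by [].
have B0 : B [::] = 0 by [].
have AB0 : (- A - B) [::] = 0 by rewrite ncD !ncN A0 B0 oppr0 addr0.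
have y0 i : y i [::] = 0.
  by case: i => [[|[|[|//]]] lti].
pose omega (z : R) : ncseries R[i] 2 :=
  (z^-1)%:C *: A + ((z - 1)^-1)%:C *: B + ((z + 1)^-1)%:C *: (- A - B).
have omega_nil z : omega z [::] = 0.
  by rewrite /omega !ncD !ncZ ncD !ncN A0 B0 oppr0 addr0 !mulr0 !addr0.
have solG G : nc_solution (fun u => (u^-1)%:C *: A + ((u - 1)^-1)%:C *: B) G ->
    ncsolves omega (fun z => G (moebius z)).
  move=> sG; apply: eq_ncsolves (ncsolves_comp (@moebius01 R)
    (@is_derive_moebius R) (nc_solution_solves sG)) => z z01.
  exact: moebius_pullback.
have solH H : nc_solution (fun z => (z^-1)%:C *: ncX R[i] (0 : 'I_3)
      + ((z - 1)^-1)%:C *: ncX R[i] (1 : 'I_3)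
      + ((z + 1)^-1)%:C *: ncX R[i] (2 : 'I_3)) H ->
    ncsolves omega (fun z => nceval y (H z)).
  move=> sH; apply: eq_ncsolves (ncsolves_eval y0 (nc_solution_solves sH)) => z _.
  by rewrite !ncevalD !ncevalZ !ncevalX.
have yA : y 0 = A by [].
have yB : y 1 = B by [].
have G0E : forall z : R, 0 < z < 1 -> G0 (moebius z) = nceval y (H0 z) * ncpow 2 A.
  apply: (@ncsolves_rescale R 2 omega _ _ ((0 : R)^'+) id (fun z => 2 / (1 + z)) 2 A).
  - exact: near_right01.
  - exact: omega_nil.
  - exact: A0.
  - by move=> z /andP[].
  - by move=> z /andP[z0 z1]; apply: divr_gt0; lra.
  - by [].
  - exact: cvg_moebius_slope0.
  - exact: solG.
  - exact: (@nccvg_comp R 2 _ _ _ (fun u => G0 u * ncpow u (- A)) _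
      (@cvg_moebius_right0 R) G0lim).
  - exact: solH.
  - exact: (@nccvg_eval_pow R 3 2 y 0 A _ (fun z => z) H0 _ y0 yA H0lim).
have G1E : forall z : R, 0 < z < 1 -> G1 (moebius z) = nceval y (H1 z) * ncpow (2^-1) B.
  apply: (@ncsolves_rescale R 2 omega _ _ ((1 : R)^'-) (fun z => 1 - z) (fun z => (1 + z)^-1) 2^-1 B).
  - exact: near_left01.
  - exact: omega_nil.
  - exact: B0.
  - by move=> z /andP[z0 z1]; lra.
  - by move=> z /andP[z0 z1]; rewrite invr_gt0; lra.
  - by rewrite invr_gt0.
  - exact: cvg_moebius_slope1.
  - exact: solG.
  - have lim1 := @nccvg_comp R 2 _ _ _
      (fun u => G1 u * ncpow (1 - u) (- B)) _ (@cvg_moebius_left1 R) G1lim.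
    apply: (nccvg_near _ _ lim1); apply: filterS (near_left01 R) => z z01.
    exact: (congr1 (fun t => G1 (moebius z) * ncpow t (- B)) (moebius_compl z01)).
  - exact: solH.
  - exact: (@nccvg_eval_pow R 3 2 y 1 B _ (fun z => 1 - z) H1 _ y0 yB H1lim).
(* G1^-1 G0 and H1^-1 H0 are constant; compare them at z = 1/2. *)
have [z01 u01] : 0 < (2^-1 : R) < 1 /\ 0 < moebius (2^-1 : R) < 1.
  have z01 : 0 < (2^-1 : R) < 1 by lra.
  by split; [|exact: moebius01].
have H0U := exp_lie_unit (let: And3 e _ _ := sH0 _ z01 in e).
have H1U := exp_lie_unit (let: And3 e _ _ := sH1 _ z01 in e).
rewrite (PhiE _ u01) (PsiE _ z01) (G0E _ z01) (G1E _ z01) /eval3 -/y.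
rewrite ncevalM ?ncevalV // invrM; [|exact: nceval_unit|exact: ncpow_unit].
by rewrite ncpow_invr // !mulrA.
Qed.
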